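(* For every integer $n\geq 2$, the polynomials $B_n^+(s,t)$ and $B_n^-(s,t)$ are both gamma positive with the same center of symmetry $n/2$ if and only if $n\equiv 0\pmod 2$.
   Context: $\mathfrak{B}_n$ is the group of signed permutations: bijections $\pi$ of $\{\pm1,\dots,\pm n\}$ with $\pi(-i)=-\pi(i)$; write $\pi_i=\pi(i)$ and $\pi_0=0$. $\mathsf{inv}_B(\pi)=|\{1\le i<j\le n:\pi_i>\pi_j\}|+|\{1\le i<j\le n:-\pi_i>\pi_j\}|+|\{i\in[n]:\pi_i<0\}|$; $\mathfrak{B}_n^+$ is the set of $\pi$ with $\mathsf{inv}_B(\pi)$ even, $\mathfrak{B}_n^-=\mathfrak{B}_n\setminus\mathfrak{B}_n^+$. $\mathsf{des}_B(\pi)=|\{i\in\{0,\dots,n-1\}:\pi_i>\pi_{i+1}\}|$, $\mathsf{asc}_B(\pi)=n-\mathsf{des}_B(\pi)$. $B_n^{\pm}(s,t)=\sum_{\pi\in\mathfrak{B}_n^{\pm}}t^{\mathsf{des}_B(\pi)}s^{\mathsf{asc}_B(\pi)}$ (homogeneous of degree $n$). A homogeneous polynomial $f(s,t)$ of degree $d$ is gamma positive if $f(s,t)=\sum_{i=0}^{\lfloor d/2\rfloor}\gamma_i(st)^i(s+t)^{d-2i}$ with all $\gamma_i\ge0$; the center of symmetry of a nonzero such polynomial, whose exponents of $t$ range from smallest $r$ to largest $N$, is $(N+r)/2$. *)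

(* Defs.v *)
From HB Require Import structures.
From mathcomp Require Import all_boot all_order all_fingroup all_algebra.
From mathcomp Require Export mpoly.
Set Implicit Arguments.
Unset Strict Implicit.
Unset Printing Implicit Defensive.

Import Order.TTheory GRing.Theory Num.Theory.
Local Open Scope ring_scope.

(* The alphabet {±1, ..., ±n}: (i, false) stands for i + 1 and (i, true) for
   -(i + 1). *)
Definition letter (n : nat) : finType := ('I_n * bool)%type.

Definition letter_val (n : nat) (x : letter n) : int :=
  (-1) ^+ x.2 * (x.1.+1)%:Z.

Definition letter_opp (n : nat) (x : letter n) : letter n := (x.1, ~~ x.2).

Definition signed_perms (n : nat) : {set {perm letter n}} :=
  [set p : {perm letter n} | [forall x, p (letter_opp x) == letter_opp (p x)]].

(* entry p k is pi_k for 0 <= k <= n, with pi_0 = 0; the value for k > n is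
   junk. *)
Definition entry (n : nat) (p : {perm letter n}) (k : nat) : int :=
  if k is k'.+1 then
    oapp (fun i : 'I_n => letter_val (p (i, false))) 0 (insub k')
  else 0.

(* An index i of {1, ..., n} is represented by i - 1 : 'I_n. *)
Definition invB (n : nat) (p : {perm letter n}) : nat :=
  (#|[set ij : 'I_n * 'I_n |
       (ij.1 < ij.2)%N && (entry p ij.1.+1 > entry p ij.2.+1)%R]|
   + #|[set ij : 'I_n * 'I_n |
         (ij.1 < ij.2)%N && (- entry p ij.1.+1 > entry p ij.2.+1)%R]|
   + #|[set i : 'I_n | (entry p i.+1 < 0)%R]|)%N.

Definition desB (n : nat) (p : {perm letter n}) : nat :=
  #|[set i : 'I_n | entry p i > entry p i.+1]|.

Definition ascB (n : nat) (p : {perm letter n}) : nat := (n - desB p)%N.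

Definition Bplus (n : nat) : {set {perm letter n}} :=
  [set p in signed_perms n | ~~ odd (invB p)].

Definition Bminus (n : nat) : {set {perm letter n}} :=
  signed_perms n :\: Bplus n.

Definition idx_s : 'I_2 := ord0.
Definition idx_t : 'I_2 := ord_max.

Definition Bplus_poly (R : nzRingType) (n : nat) : {mpoly R[2]} :=
  \sum_(p in Bplus n) 'X_idx_t ^+ desB p * 'X_idx_s ^+ ascB p.

Definition Bminus_poly (R : nzRingType) (n : nat) : {mpoly R[2]} :=
  \sum_(p in Bminus n) 'X_idx_t ^+ desB p * 'X_idx_s ^+ ascB p.

Definition gamma_positive (R : realDomainType) (f : {mpoly R[2]}) : Prop :=
  exists2 d : nat, f \is d.-homog &
  exists2 gamma : nat -> R, (forall i, (i <= d./2)%N -> 0 <= gamma i) &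
    f = \sum_(i < (d./2).+1)
          gamma i *: (('X_idx_s * 'X_idx_t) ^+ i
                      * ('X_idx_s + 'X_idx_t) ^+ (d - i.*2)).

Definition t_exponents (R : nzRingType) (f : {mpoly R[2]}) : seq nat :=
  [seq m idx_t | m : 'X_{1..2} <- msupp f].

(* Relational, so that it can only hold for f <> 0. *)
Definition center_of_symmetry (R : nzRingType) (f : {mpoly R[2]}) (c : rat) :
    Prop :=
  exists r N : nat,
    [/\ r \in t_exponents f, N \in t_exponents f,
        (forall e, e \in t_exponents f -> (r <= e <= N)%N)
      & c = (N + r)%:R / 2].

(* Main.v *)
(** Writing signed permutations as words and inserting the letters n+1 and
    -(n+1) in all positions gives two recurrences. Insertions of n+1 and
    -(n+1) at the same non-final place have the same descents and opposite
    signs, so B_n^+ - B_n^- = (s - t)^n; forgetting signs, B_{n+1} = (s + t)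
    B_n + 2 s t (d/ds + d/dt) B_n. In the basis (st)^i (s+t)^(n-2i) the
    latter shows that B_n has coefficients 4^i g(n, i), where g(n, i) is the
    number of permutations with i left peaks and g(2m, i) >= C(m, i). For n
    = 2m, (s - t)^n = ((s + t)^2 - 4st)^m has coefficients (-4)^i C(m, i),
    so that B_n^+ and B_n^- = (B_n +- (s - t)^n) / 2 have nonnegative
    coefficients, which are integers: 4^i is even for i > 0, and the
    coefficients at i = 0 are 1 and 0. For n odd, B_n^+ is not symmetric: it
    takes the values 1 at (1, 0) and 0 at (0, 1). *)
Require Import Defs.
From HB Require Import structures.
From mathcomp Require Import all_boot all_order all_fingroup all_algebra.
From mathcomp Require Import zify ring.
Set Implicit Arguments.
Unset Strict Implicit.
Unset Printing Implicit Defensive.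

Import Order.TTheory GRing.Theory Num.Theory.
Local Open Scope ring_scope.

(** * Words of signed letters, their statistics, and generation by insertion *)

Fixpoint word_des (x : int) (w : seq int) : nat :=
  if w is y :: w' then ((y < x)%R + word_des y w')%N else 0.

(** The weak inequality makes ascents the complement of descents for every word, matching the
    subtraction in [ascB]. *)
Fixpoint word_asc (x : int) (w : seq int) : nat :=
  if w is y :: w' then ((x <= y)%R + word_asc y w')%N else 0.

(** The share of inv_B due to the first letter [x]: the pairs of both kinds that it begins, and its
    own sign. *)
Definition head_inv (x : int) (w : seq int) : nat :=
  (count (fun y => y < x)%R w + count (fun y => y < - x)%R w + (x < 0)%R)%N.

Fixpoint word_inv (w : seq int) : nat :=
  if w is x :: w' then (head_inv x w' + word_inv w')%N else 0.

Lemma word_des_asc x w : (word_des x w + word_asc x w)%N = size w.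
Proof. by elim: w x => //= y w IH x; rewrite -(IH y) leNgt; case: (y < x); lia. Qed.

Definition insert (k : nat) (x : int) (w : seq int) : seq int :=
  take k w ++ x :: drop k w.

Definition unsign_word (w : seq int) : seq nat := [seq `|x|%N | x <- w].

(** A slot is a place of insertion with the sign of the inserted letter, [true] meaning negative. *)
Definition slots (n : nat) : seq (nat * bool) :=
  [seq (k, b) | k <- iota 0 n, b <- [:: false; true]].

Arguments slots : simpl never.

Lemma mem_slots n kb : (kb \in slots n) = (kb.1 < n)%N.
Proof.
apply/allpairsP/idP => [[[k b] [/= kn _ ->]] /=|kn].
  by move: kn; rewrite mem_iota.
by exists kb; split; [rewrite mem_iota|case: (kb.2)|case: kb {kn}].
Qed.

Lemma uniq_slots n : uniq (slots n).
Proof. by apply: allpairs_uniq; rewrite ?iota_uniq // => -[? ?] [? ?]. Qed.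

Fixpoint words (n : nat) : seq (seq int) :=
  if n is m.+1 then
    [seq insert kb.1 ((-1) ^+ nat_of_bool kb.2 * m.+1%:Z) w
       | w <- words m, kb <- slots m.+1]
  else [:: [::]].

Lemma wordsS n :
  words n.+1 = [seq insert kb.1 ((-1) ^+ nat_of_bool kb.2 * n.+1%:Z) w
                  | w <- words n, kb <- slots n.+1].
Proof. by []. Qed.

Lemma perm_insert k x w : perm_eq (insert k x w) (x :: w).
Proof.
rewrite /insert -cat1s perm_catCA cat1s perm_cons.
by rewrite cat_take_drop.
Qed.

Lemma count_lt_insert (a : int) k x w :
  count (fun y => y < a)%R (insert k x w) =
  ((x < a)%R + count (fun y => y < a)%R w)%N.
Proof. by rewrite (seq.permP (perm_insert k x w)). Qed.

Lemma iota1S n : perm_eq (iota 1 n.+1) (n.+1 :: iota 1 n).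
Proof. by rewrite -(addn1 n) iotaD add1n addn1 perm_catC. Qed.

(** Deleting the letter of absolute value [n.+1] undoes an insertion, and the place and sign of that
    letter give the slot. *)
Lemma mem_words n (w : seq int) : (w \in words n) = perm_eq (unsign_word w) (iota 1 n).
Proof.
elim: n w => [|n IH] w.
  by rewrite inE; apply/eqP/idP => [->//|/perm_nilP]; case: w.
apply/idP/idP.
  move=> /allpairsP[[v [k b]] /= [vn _ ->]].
  have /perm_trans -> // := perm_map absz (perm_insert k ((-1) ^+ b * n.+1%:Z) v).
  rewrite /= abszMsign perm_sym (perm_trans (iota1S n)) // perm_cons perm_sym.
  by rewrite -IH.
move=> pw.
have: n.+1 \in unsign_word w by rewrite (perm_mem pw) mem_iota; lia.
case/mapP => x xw Nx; case/splitPr: xw pw => w1 w2 pw.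
have pw12 : perm_eq (unsign_word (w1 ++ w2)) (iota 1 n).
  rewrite -(perm_cons n.+1) perm_sym -(permPl (iota1S n)) perm_sym.
  rewrite -(permPr pw) /unsign_word !map_cat /= -Nx -cat1s perm_sym.
  by rewrite -cat1s perm_catCA.
have sz : size (w1 ++ w2) = n.
  by rewrite -(size_iota 1 n) -(perm_size pw12) size_map.
apply/allpairsP; exists (w1 ++ w2, (size w1, x < 0)); split => /=.
- by rewrite IH.
- by rewrite mem_slots -sz size_cat /=; lia.
- rewrite /insert take_size_cat // drop_size_cat //; congr (_ ++ _ :: _).
  by rewrite Nx; case: (ltP x 0) => x0; rewrite ?expr0 ?expr1; lia.
Qed.

Lemma uniq_words n : uniq (words n).
Proof.
elim: n => // n IH.
pose big (y : int) := `|y|%N == n.+1.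
(* A left inverse of insertion: drop the letter of absolute value [n.+1] and record its place and
   sign. *)
pose unins z := ([seq y <- z | ~~ big y], (find big z, nth 0 z (find big z) < 0)).
rewrite wordsS; apply: allpairs_uniq => //.
  exact: uniq_slots.
apply: (@can_in_inj _ _ _ _ unins) => -[v [k b]].
case/allpairsP => -[v' [k' b']] [/= vn kn [-> -> ->]] {v k b}.
rewrite mem_words in vn.
have sz : size v' = n by rewrite -(size_iota 1 n) -(perm_size vn) size_map.
have {kn} kn : (k' <= n)%N.
  by rewrite mem_slots in kn.
have nb : all (predC big) v'.
  apply/allP => y yv /=; apply/negP => /eqP yN.
  have : n.+1 \in unsign_word v' by rewrite -yN map_f.
  by rewrite (perm_mem vn) mem_iota; lia.
have [nb1 nb2] : all (predC big) (take k' v') /\ all (predC big) (drop k' v').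
  by apply/andP; rewrite -all_cat cat_take_drop.
have bx : big ((-1) ^+ b' * n.+1%:Z) by rewrite /big abszMsign.
have fk : find big (insert k' ((-1) ^+ b' * n.+1%:Z) v') = k'.
  move: nb1; rewrite all_predC => /negbTE nb1.
  by rewrite /insert find_cat nb1 /= bx size_takel ?sz // addn0.
rewrite /unins fk; congr (_, (_, _)).
  rewrite /insert filter_cat /= bx /= -[RHS](cat_take_drop k').
  by congr (_ ++ _); apply/all_filterP.
rewrite /insert nth_cat size_takel ?sz // ltnn subnn /=.
by case: (b'); rewrite ?expr0 ?expr1; lia.
Qed.

Lemma words_bound n w : w \in words n ->
  size w = n /\ all (fun y : int => `|y| < n.+1)%N w.
Proof.
rewrite mem_words => pw; split.
  by rewrite -(size_iota 1 n) -(perm_size pw) size_map.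
apply/allP => y yw; have : `|y|%N \in unsign_word w by rewrite map_f.
by rewrite (perm_mem pw) mem_iota; lia.
Qed.

Lemma big_words (A : nmodType) n (F : seq int -> A) :
  \sum_(w <- words n.+1) F w =
  \sum_(w <- words n) \sum_(k < n.+1)
     (F (insert k n.+1%:Z w) + F (insert k (- n.+1%:Z) w)).
Proof.
rewrite wordsS big_allpairs_dep; apply: eq_bigr => w _.
rewrite /slots big_allpairs -[iota _ _]/(index_iota 0 n.+1) big_mkord.
apply: eq_bigr => k _.
by rewrite big_cons big_seq1 expr0 expr1 mul1r mulN1r.
Qed.

(** * Recurrences for the plain and the signed sum of weights *)

Section WordWeights.
Variable R : comNzRingType.
Local Notation S := ('X_idx_s : {mpoly R[2]}).
Local Notation T := ('X_idx_t : {mpoly R[2]}).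

Definition weight (x : int) (w : seq int) : {mpoly R[2]} :=
  T ^+ word_des x w * S ^+ word_asc x w.

Lemma weight_cons x y w :
  weight x (y :: w) = (if y < x then T else S) * weight y w.
Proof.
rewrite /weight /= leNgt; case: (y < x) => /=.
  by rewrite add1n add0n exprS mulrA.
by rewrite add1n add0n exprS; ring.
Qed.

Definition diag_deriv (p : {mpoly R[2]}) := p^`M(idx_s) + p^`M(idx_t).

Lemma diag_derivM p q :
  diag_deriv (p * q) = diag_deriv p * q + p * diag_deriv q.
Proof. by rewrite /diag_deriv !mderivM; ring. Qed.

Lemma diag_deriv1 : diag_deriv 1 = 0.
Proof. by rewrite /diag_deriv -mpolyC1 !mderivC addr0. Qed.

Lemma diag_deriv_sum (I : Type) (r : seq I) (F : I -> {mpoly R[2]}) :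
  diag_deriv (\sum_(i <- r) F i) = \sum_(i <- r) diag_deriv (F i).
Proof. by rewrite /diag_deriv !raddf_sum -big_split. Qed.

Lemma diag_derivX i : diag_deriv 'X_i = 1.
Proof.
have [->|->] : i = idx_s \/ i = idx_t.
  by case: i => [[|[|//]] ?]; [left|right]; apply/val_inj.
all: by rewrite /diag_deriv !mderivX !mnmE /= scale1r scale0r ?add0r ?addr0
    -[X in 'X_[X - _]]addm0 addmC addmK mpolyX0.
Qed.

Lemma diag_derivXn p k : diag_deriv (p ^+ k) = k%:R * (p ^+ k.-1 * diag_deriv p).
Proof.
elim: k => [|k IH]; first by rewrite diag_deriv1 mul0r.
rewrite exprS diag_derivM IH /= -natr1; case: k {IH} => [|k] /=;
    rewrite ?expr0; try ring.
by rewrite exprS; ring.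
Qed.

(** Inserting [N] or [- N] between two letters replaces the factor of that gap, [S] or [T], by
    [S * T]. Since [diag_deriv] sends both variables to 1, it sums the weights with one factor
    deleted, whence the second term. At the end of the word, [N] adds a factor [S] and [- N] a
    factor [T]. *)
Lemma sum_insert_weight (N : nat) x w :
  (`|x| < N)%N -> all (fun y : int => `|y| < N)%N w ->
  \sum_(k < (size w).+1)
     (weight x (insert k N%:Z w) + weight x (insert k (- N%:Z) w))
  = (S + T) * weight x w + 2 * (S * T) * diag_deriv (weight x w).
Proof.
elim: w x => [|y w IH] x xN /=.
  move=> _; rewrite big_ord_recl big_ord0 /insert /= !weight_cons.
  have [-> ->] : N%:Z < x = false /\ (- N%:Z < x) by lia.
  by rewrite /weight /= !expr0 !mulr1 diag_deriv1; ring.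
case/andP => yN wN; rewrite big_ord_recl /insert /= !weight_cons.
under eq_bigr => k _ do rewrite !weight_cons -mulrDr -!/(insert _ _ _).
rewrite -mulr_sumr IH // diag_derivM.
have [-> ->] : N%:Z < x = false /\ (- N%:Z < x) by lia.
have [-> ->] : (y < N%:Z) /\ y < - N%:Z = false by lia.
by case: (y < x); rewrite diag_derivX; ring.
Qed.

(** At each gap the insertions of [N] and [- N] have equal weights and opposite signs, so they
    cancel. Only the end of the word remains, where [N] keeps the sign and [- N] reverses it. *)
Lemma sum_insert_signed_weight (N : nat) x w :
  (`|x| < N)%N -> all (fun y : int => `|y| < N)%N w ->
  \sum_(k < (size w).+1)
     ((-1) ^+ word_inv (insert k N%:Z w) * weight x (insert k N%:Z w)
      + (-1) ^+ word_inv (insert k (- N%:Z) w) * weight x (insert k (- N%:Z) w))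
  = (-1) ^+ word_inv w * ((S - T) * weight x w).
Proof.
elim: w x => [|y w IH] x xN.
  move=> _; rewrite big_ord_recl big_ord0 /insert /= !weight_cons /head_inv /=.
  have [-> ->] : N%:Z < x = false /\ (- N%:Z < x) by lia.
  have -> : - N%:Z < 0 by lia.
  by rewrite /weight /= !expr0 expr1; ring.
case/andP => yN wN; rewrite big_ord_recl.
have -> : insert (@ord0 (size w)) N%:Z (y :: w) = N%:Z :: y :: w by [].
have -> : insert (@ord0 (size w)) (- N%:Z) (y :: w) = - N%:Z :: y :: w by [].
(* With each later letter, a leading [N] forms an inversion of the first kind only, a leading [- N]
   one of the second kind only; the parities thus differ just by the sign of [z]. *)
have head z : z \in [:: N%:Z; - N%:Z] ->
  (-1) ^+ word_inv (z :: y :: w) =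
  (-1) ^+ (z < 0)%R * (-1) ^+ (size w).+1 * (-1) ^+ word_inv (y :: w) :> {mpoly R[2]}.
  move=> zN; rewrite [word_inv (z :: _)]/= exprD; congr (_ * _).
  rewrite /head_inv addnC exprD; congr (_ * (-1) ^+ _).
  have yw : all (fun y : int => `|y| < N)%N (y :: w) by rewrite /= yN.
  rewrite -[(size w).+1]/(size (y :: w)); move: zN; rewrite !inE.
  case/orP => /eqP ->; rewrite ?opprK.
    rewrite [X in (_ + X)%N](_ : _ = 0%N) ?addn0.
      by apply/eqP; rewrite -all_count; apply: sub_all yw => a /=; lia.
    apply/eqP; rewrite -leqn0 leqNgt -has_count -all_predC.
    by apply: sub_all yw => a /=; lia.
  rewrite [X in (X + _)%N](_ : _ = 0%N) ?add0n.
    by apply/eqP; rewrite -all_count; apply: sub_all yw => a /=; lia.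
  apply/eqP; rewrite -leqn0 leqNgt -has_count -all_predC.
  by apply: sub_all yw => a /=; lia.
rewrite !head ?inE ?eqxx ?orbT //.
have tail (k : 'I_(size w).+1) z : z \in [:: N%:Z; - N%:Z] ->
  (-1) ^+ word_inv (insert (lift ord0 k) z (y :: w)) =
  (-1) ^+ head_inv y w * (-1) ^+ word_inv (insert k z w) :> {mpoly R[2]}.
  move=> zN; rewrite -[insert _ _ _]/(y :: insert k z w) [word_inv _]/= exprD.
  congr (_ * _); rewrite /head_inv !count_lt_insert.
  (* Both comparisons amount to [z < 0], so [z] adds 0 or 2 to the share of an earlier letter
     [y]. *)
  have <- : (z < y) = (z < - y) by move: zN; rewrite !inE; lia.
  rewrite addnACA addnn -addnA exprD.
  by rewrite -signr_odd odd_double expr0 mul1r.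
set c := (if y < x then T else S).
rewrite (eq_bigr (fun k : 'I_(size w).+1 => (-1) ^+ head_inv y w * c *
  ((-1) ^+ word_inv (insert k N%:Z w) * weight y (insert k N%:Z w)
   + (-1) ^+ word_inv (insert k (- N%:Z) w) * weight y (insert k (- N%:Z) w))));
  last first.
  move=> k _; rewrite !tail ?inE ?eqxx ?orbT //.
  rewrite -![insert (lift _ _) _ _]/(y :: insert k _ w) !weight_cons -/c.
  by ring.
rewrite -mulr_sumr IH // !weight_cons -/c [word_inv (y :: w)]/=.
have [-> ->] : N%:Z < x = false /\ (- N%:Z < x) by lia.
have [-> ->] : (y < N%:Z) /\ y < - N%:Z = false by lia.
have [-> ->] : N%:Z < 0 = false /\ (- N%:Z < 0) by lia.
by rewrite exprD expr0 expr1; ring.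
Qed.

Definition words_poly n := \sum_(w <- words n) weight 0 w.

Lemma words_polyS n :
  words_poly n.+1 =
  (S + T) * words_poly n + 2 * (S * T) * diag_deriv (words_poly n).
Proof.
rewrite /words_poly big_words diag_deriv_sum.
rewrite !mulr_sumr -big_split; apply: eq_big_seq => w /words_bound[sz wn].
by have := @sum_insert_weight n.+1 0 w isT wn; rewrite sz.
Qed.

Lemma signed_words_poly n :
  \sum_(w <- words n) (-1) ^+ word_inv w * weight 0 w = (S - T) ^+ n.
Proof.
elim: n => [|n IH]; first by rewrite big_seq1 /weight /= !expr0 !mulr1.
rewrite big_words exprS -IH mulr_sumr.
apply: eq_big_seq => w /words_bound[sz wn].
by have := @sum_insert_signed_weight n.+1 0 w isT wn; rewrite sz mulrCA.
Qed.

End WordWeights.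

(** * The bijection between signed permutations and words *)

Lemma absz_letter_val n (x : letter n) : `|letter_val x|%N = x.1.+1.
Proof. by rewrite /letter_val abszMsign. Qed.

Lemma letter_val_lt0 n (x : letter n) : (letter_val x < 0) = x.2.
Proof. by rewrite /letter_val; case: (x.2); rewrite ?expr0 ?expr1; lia. Qed.

Lemma letter_val_inj n : injective (@letter_val n).
Proof.
move=> x y xy.
have := absz_letter_val x; have := letter_val_lt0 x.
rewrite xy absz_letter_val letter_val_lt0 => y2 [y1].
by apply/eqP; rewrite -pair_eqE /pair_eq /= y2 eqxx andbT -val_eqE /= y1.
Qed.

Lemma entryS n (p : {perm letter n}) (i : 'I_n) :
  entry p i.+1 = letter_val (p (i, false)).
Proof. by rewrite /entry valK. Qed.

Lemma signed_permsP n (p : {perm letter n}) :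
  reflect (forall x, p (letter_opp x) = letter_opp (p x)) (p \in signed_perms n).
Proof. by rewrite inE; apply: (iffP forallP) => h x; apply/eqP; rewrite h. Qed.

Definition word n (p : {perm letter n}) : seq int :=
  [seq entry p k.+1 | k <- iota 0 n].

Lemma size_word n (p : {perm letter n}) : size (word p) = n.
Proof. by rewrite size_map size_iota. Qed.

Lemma nth_word n (p : {perm letter n}) (i : 'I_n) :
  nth 0 (word p) i = letter_val (p (i, false)).
Proof. by rewrite (nth_map 0%N) ?size_iota // nth_iota // add0n entryS. Qed.

Lemma word_inj n : {in signed_perms n &, injective (@word n)}.
Proof.
move=> p q /signed_permsP ps /signed_permsP qs pq; apply/permP => -[i b].
have pqi : p (i, false) = q (i, false).
  by apply: letter_val_inj; rewrite -!nth_word pq.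
by case: b => //; rewrite -[(i, true)]/(letter_opp (i, false)) ps qs pqi.
Qed.

Lemma word_in_words n (p : {perm letter n}) :
  p \in signed_perms n -> word p \in words n.
Proof.
move=> /signed_permsP ps; rewrite mem_words.
have nth_abs (i : 'I_n) : nth 0%N (unsign_word (word p)) i = (p (i, false)).1.+1.
  by rewrite (nth_map 0) ?size_word // nth_word absz_letter_val.
have sz : size (unsign_word (word p)) = n by rewrite size_map size_word.
have u : uniq (unsign_word (word p)).
  apply/(uniqP 0%N) => i j; rewrite !inE sz => ilt jlt.
  rewrite (nth_abs (Ordinal ilt)) (nth_abs (Ordinal jlt)) => -[] /val_inj ij.
  (* Values with equal absolute value agree up to sign, and a sign can be moved from the value to
     the argument. *)
  have [/perm_inj[]//|/perm_inj[]//] :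
      p (Ordinal ilt, false) = p (Ordinal jlt, false) \/
      p (Ordinal ilt, false) = p (Ordinal jlt, true).
  rewrite -[(_, true)]/(letter_opp (Ordinal jlt, false)) ps; move: ij.
  by case: (p _) (p (Ordinal jlt, _)) => a [] [b []] /= ->; auto.
have [||_ eq_mem] := uniq_min_size u (s2 := iota 1 n).
- move=> k /(nthP 0%N)[i]; rewrite sz => ilt <-.
  by rewrite (nth_abs (Ordinal ilt)) mem_iota add1n ltnS; case: (p _).1.
- by rewrite sz size_iota.
by apply: uniq_perm; rewrite ?iota_uniq.
Qed.

Lemma word_surj n (w : seq int) :
  w \in words n -> exists2 p, p \in signed_perms n & word p = w.
Proof.
rewrite mem_words => pw.
have sz : size w = n by rewrite -(size_iota 1 n) -(perm_size pw) size_map.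
have abs_lt (i : 'I_n) : (0 < (absz (nth 0%R w i)) < n.+1)%N.
  have : (absz (nth 0%R w i)) \in unsign_word w by rewrite map_f // mem_nth // sz.
  by rewrite (perm_mem pw) mem_iota add1n.
have abs_inj (i j : 'I_n) : (absz (nth 0%R w i)) = (absz (nth 0%R w j)) -> i = j.
  move=> e; apply/ord_inj/eqP.
  have u : uniq (unsign_word w) by rewrite (perm_uniq pw) iota_uniq.
  rewrite -(nth_uniq 0%N _ _ u) ?size_map ?sz //.
  by rewrite !(nth_map 0) ?sz // e.
(* The index is the absolute value minus 1, because indices start at 0; by [abs_lt] the default
   [x.1] is never taken. A negative argument flips the sign of the value. *)
pose f (x : letter n) : letter n :=
  (insubd x.1 (absz (nth 0%R w x.1)).-1, (nth 0 w x.1 < 0) (+) x.2).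
have f1 x : val (f x).1 = (absz (nth 0%R w x.1)).-1.
  by rewrite insubdK // unfold_in; have := abs_lt x.1; case: absz.
have f_inj : injective f.
  move=> x y e; have e1 : x.1 = y.1.
    apply: abs_inj; have := f1 x; rewrite e f1.
    by have := abs_lt x.1; have := abs_lt y.1; lia.
  case: x y e1 e => [i b] [j c] /= <- /(congr1 snd) /= e; congr (_, _).
  exact: addbI e.
exists (perm f_inj).
  apply/signed_permsP => x; rewrite !permE /f /letter_opp /=.
  by rewrite addbN.
apply: (@eq_from_nth _ 0); rewrite size_word ?sz // => i ilt.
rewrite (nth_word _ (Ordinal ilt)) permE /letter_val f1 /= addbF.
by have := abs_lt (Ordinal ilt); rewrite /=; case: ltP => ?;
    rewrite ?expr0 ?expr1; lia.
Qed.

Lemma big_signed_perms (A : nmodType) n (F : seq int -> A) :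
  \sum_(p in signed_perms n) F (word p) = \sum_(w <- words n) F w.
Proof.
rewrite -big_enum -(big_map (@word n) xpredT F) /=.
apply: perm_big; apply: uniq_perm; last 1 first.
- move=> w; apply/mapP/idP => [[p]|/word_surj[p pn <-]].
    by rewrite mem_enum => /word_in_words + ->.
  by exists p => //; rewrite mem_enum.
- rewrite map_inj_in_uniq ?enum_uniq // => p q; rewrite !mem_enum.
  exact: word_inj.
- exact: uniq_words.
Qed.

Lemma word_des_sum x w :
  word_des x w = (\sum_(i < size w) (nth 0 w i < nth 0 (x :: w) i)%R)%N.
Proof.
elim: w x => [|y w IH] x; first by rewrite big_ord0.
by rewrite [size _]/= big_ord_recl /= IH.
Qed.

Lemma desB_word n (p : {perm letter n}) : desB p = word_des 0 (word p).
Proof.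
rewrite word_des_sum size_word /desB -sum1_card big_mkcond; apply: eq_bigr => i _.
rewrite inE nth_word entryS.
(* The leading 0 is the entry pi_0, which shifts the word by one place. *)
suff -> : entry p i = nth 0 (0 :: word p) i by case: ifP.
case: i => [[|k] kn] //=.
by rewrite (nth_word p (Ordinal (ltnW kn))) -entryS.
Qed.

Lemma ascB_word n (p : {perm letter n}) : ascB p = word_asc 0 (word p).
Proof. by rewrite /ascB desB_word -[n in (n - _)%N](size_word p)
    -(word_des_asc 0) addKn. Qed.

(** A bridge between the cardinals in [invB], which run over pairs of indices, and the recursion of
    [word_inv] on the first letter. *)
Definition pairs (r : rel int) (w : seq int) : nat :=
  (\sum_(i < size w) \sum_(j < size w) ((i < j)%N && r (nth 0%R w i) (nth 0%R w j)))%N.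

Lemma pairs_cons r x w : pairs r (x :: w) = (count (r x) w + pairs r w)%N.
Proof.
rewrite /pairs [size _]/= big_ord_recl big_ord_recl /= add0n; congr (_ + _)%N.
  rewrite -sum1_count [RHS]big_mkcond (big_nth 0) [RHS]big_mkord;
    apply: eq_bigr => i _.
  by case: (r _ _).
by apply: eq_bigr => i _; rewrite big_ord_recl /= add0n.
Qed.

Lemma card_pairs n (r : rel int) (p : {perm letter n}) :
  #|[set ij : 'I_n * 'I_n | (ij.1 < ij.2)%N && r (entry p ij.1.+1) (entry p ij.2.+1)]|
  = pairs r (word p).
Proof.
rewrite -sum1_card [LHS]big_mkcond /pairs size_word pair_big; apply: eq_bigr => ij _.
by rewrite inE !nth_word !entryS; case: (_ && _).
Qed.

Lemma word_inv_pairs w :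
  word_inv w = (pairs (fun x y => y < x)%R w + pairs (fun x y => y < - x)%R w
           + \sum_(i < size w) (nth 0 w i < 0)%R)%N.
Proof.
elim: w => [|x w IH]; first by rewrite /pairs !big_ord0.
by rewrite !pairs_cons [size _]/= big_ord_recl /= IH /head_inv
    addnACA (addnACA (count _ _)).
Qed.

Lemma invB_word n (p : {perm letter n}) : invB p = word_inv (word p).
Proof.
rewrite word_inv_pairs /invB -!card_pairs size_word; congr (_ + _)%N.
rewrite -sum1_card [LHS]big_mkcond; apply: eq_bigr => i _.
by rewrite inE nth_word entryS; case: (_ < _).
Qed.

(** * Sum and difference of the even and odd polynomials *)

Section SplitPolys.
Variable R : comNzRingType.
Local Notation S := ('X_idx_s : {mpoly R[2]}).
Local Notation T := ('X_idx_t : {mpoly R[2]}).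

Lemma Bplus_poly_words n :
  Bplus_poly R n = \sum_(w <- words n | ~~ odd (word_inv w)) weight R 0 w.
Proof.
rewrite [RHS]big_mkcond -big_signed_perms /Bplus_poly.
rewrite -[RHS]big_mkcondr; apply: eq_big => p.
  by rewrite [LHS]inE invB_word.
by move=> _; rewrite /weight desB_word ascB_word.
Qed.

Lemma Bminus_poly_words n :
  Bminus_poly R n = \sum_(w <- words n | odd (word_inv w)) weight R 0 w.
Proof.
rewrite [RHS]big_mkcond -big_signed_perms /Bminus_poly.
rewrite -[RHS]big_mkcondr; apply: eq_big => p.
  by rewrite [LHS]inE [_ \in Bplus n]inE invB_word; case: (p \in _);
    rewrite ?andbF //= negbK andbT.
by move=> _; rewrite /weight desB_word ascB_word.
Qed.

Lemma Bplus_add_Bminus n : Bplus_poly R n + Bminus_poly R n = words_poly R n.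
Proof.
rewrite Bplus_poly_words Bminus_poly_words /words_poly.
by rewrite [RHS](bigID (fun w => odd (word_inv w))) [RHS]addrC.
Qed.

Lemma Bplus_sub_Bminus n : Bplus_poly R n - Bminus_poly R n = (S - T) ^+ n.
Proof.
rewrite Bplus_poly_words Bminus_poly_words -signed_words_poly.
rewrite [RHS](bigID (fun w => odd (word_inv w))) /= [RHS]addrC -sumrN.
congr (_ + _); apply: eq_bigr => w odd_w; rewrite -signr_odd.
  by rewrite (negbTE odd_w) expr0 mul1r.
by rewrite odd_w expr1 mulN1r.
Qed.

End SplitPolys.

(** * Left peak numbers and their binomial lower bound *)

(* The recurrence is that of the number of permutations of [n] letters with [i]
   left peaks. *)
Fixpoint left_peaks (n i : nat) : nat :=
  match n, i with
  | 0, 0 => 1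
  | 0, _.+1 => 0
  | n'.+1, 0 => left_peaks n' 0
  | n'.+1, j.+1 => j.*2.+3 * left_peaks n' j.+1 + (n' - j.*2) * left_peaks n' j
  end.

Lemma left_peaksS n j :
  left_peaks n.+1 j.+1 =
  (j.*2.+3 * left_peaks n j.+1 + (n - j.*2) * left_peaks n j)%N.
Proof. by []. Qed.

Lemma left_peaks0 n : left_peaks n 0 = 1%N.
Proof. by elim: n. Qed.

Lemma left_peaks_small n i : (n < i.*2)%N -> left_peaks n i = 0%N.
Proof.
elim: n i => [|n IH] [|i] // ni; rewrite left_peaksS IH; last by lia.
have [->|ni'] := eqVneq n i.*2; first by rewrite subnn muln0.
by rewrite IH ?muln0 //; lia.
Qed.

Lemma leq_left_peaks n i : (left_peaks n i <= left_peaks n.+1 i)%N.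
Proof. by case: i => [|i]; rewrite ?left_peaks0 // left_peaksS; nia. Qed.

(** Two rows of [left_peaks] dominate one step of the Pascal rule: for [i <= m] both factors of the
    recurrence are positive, and rows grow with [n]. *)
Lemma bin_le_left_peaks m i : ('C(m, i) <= left_peaks m.*2 i)%N.
Proof.
elim: m i => [|m IH] [|i]; rewrite ?bin0 ?left_peaks0 // binS doubleS.
have [mi|im] := ltnP m i; first by rewrite !bin_small //; lia.
rewrite left_peaksS.
have := leq_left_peaks m.*2 i.+1; have := leq_left_peaks m.*2 i.
have := IH i.+1; have := IH i.
have [k ->] : exists k, (m.*2.+1 - i.*2 = k.+1)%N.
  by exists (m.*2 - i.*2)%N; lia.
nia.
Qed.

(** * Expansions in the gamma basis *)

Section GammaExpansion.
Variable R : comNzRingType.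
Local Notation S := ('X_idx_s : {mpoly R[2]}).
Local Notation T := ('X_idx_t : {mpoly R[2]}).

(** For [d < i.*2] the truncated exponent gives a junk value; in [words_poly_gamma] its coefficient
    is then 0 by [left_peaks_small]. *)
Definition gamma_basis (d i : nat) : {mpoly R[2]} :=
  (S * T) ^+ i * (S + T) ^+ (d - i.*2).

Lemma diag_deriv_natM k (p : {mpoly R[2]}) :
  diag_deriv (k%:R * p) = k%:R * diag_deriv p.
Proof. by rewrite !mulr_natl /diag_deriv !raddfMn -mulrnDl. Qed.

(** The derivation sends [S * T] to [S + T] and [S + T] to 2. Differentiating the first power gives
    [i.*2] copies of the same index, to which [S + T] adds one; differentiating the second raises
    the index. *)
Lemma gamma_basis_step n i : (i.*2 <= n)%N ->
  (S + T) * gamma_basis n i + 2 * (S * T) * diag_deriv (gamma_basis n i)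
  = (i.*2.+1)%:R * gamma_basis n.+1 i
    + (4 * (n - i.*2))%:R * gamma_basis n.+1 i.+1.
Proof.
move=> le_in; rewrite /gamma_basis diag_derivM !diag_derivXn diag_derivM.
have -> : diag_deriv (S + T) = 2.
  transitivity (diag_deriv S + diag_deriv T); last by rewrite !diag_derivX.
  by rewrite /diag_deriv !mderivD addrACA.
rewrite !diag_derivX doubleS subSS subnS subSn //.
move: (n - i.*2)%N => k; rewrite [(S + T) ^+ k.+1]exprS.
have -> : (i.*2.+1)%:R = 2 * i%:R + 1 :> {mpoly R[2]}.
  by rewrite -natr1 -muln2 natrM mulrC.
rewrite natrM [(S * T) ^+ i.+1]exprS.
case: i {le_in} => [|i]; case: k => [|k] /=;
    rewrite ?expr0 ?(exprS _ i) ?(exprS _ k); ring.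
Qed.

Lemma words_poly_gamma n :
  words_poly R n =
  \sum_(i < n.+1) (4 ^ i * left_peaks n i)%:R * gamma_basis n i.
Proof.
elim: n => [|n IH].
  rewrite /words_poly big_seq1 big_ord_recl big_ord0 /weight /gamma_basis /=.
  by rewrite !expr0 !mulr1 addr0.
rewrite words_polyS {}IH diag_deriv_sum !mulr_sumr -big_split /=.
(* [F] gathers the contributions that keep the index and [G] those that raise it; together they
   reproduce the recurrence of [left_peaks]. *)
pose F i := (4 ^ i * left_peaks n i * i.*2.+1)%:R * gamma_basis n.+1 i.
pose G i := (4 ^ i.+1 * (left_peaks n i * (n - i.*2)))%:R * gamma_basis n.+1 i.+1.
transitivity (\sum_(i < n.+1) (F i + G i)).
  apply: eq_bigr => i _; rewrite diag_deriv_natM /F /G.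
  have [le_in|lt_ni] := leqP i.*2 n; last first.
    by rewrite left_peaks_small // !(muln0, mul0n, mul0r, mulr0, addr0).
  have := gamma_basis_step le_in; rewrite !natrM expnS natrM.
  set a := (4 ^ i)%:R; set b := (left_peaks n i)%:R => e.
  transitivity (a * b * ((S + T) * gamma_basis n i
    + 2 * (S * T) * diag_deriv (gamma_basis n i))); first by ring.
  by rewrite e; ring.
have Fn : F n.+1 = 0 by rewrite /F left_peaks_small ?muln0 ?mul0n ?mul0r //; lia.
have extF : \sum_(i < n.+1) F i = \sum_(i < n.+2) F i.
  by rewrite [RHS]big_ord_recr /= Fn addr0.
rewrite big_split /= extF.
rewrite big_ord_recl -addrA -big_split [RHS]big_ord_recl /=; congr (_ + _).
  by rewrite /F /= left_peaks0 !muln1.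
apply: eq_bigr => i _; rewrite /F /G /bump add1n /= -mulrDl -natrD.
by congr (_%:R * _); rewrite ?doubleS; ring.
Qed.

Lemma signed_gamma m :
  (S - T) ^+ m.*2 =
  \sum_(i < m.+1) (-1) ^+ i * (4 ^ i * 'C(m, i))%:R * gamma_basis m.*2 i.
Proof.
have -> : (S - T) ^+ m.*2 = ((S + T) ^+ 2 - 4 * (S * T)) ^+ m.
  by rewrite -mul2n exprM; congr (_ ^+ _); ring.
rewrite exprBn; apply: eq_bigr => i _.
rewrite /gamma_basis -doubleB -mul2n -exprM exprMn natrM natrX -mulr_natr; ring.
Qed.

End GammaExpansion.

(** * Gamma positivity, symmetry and centers *)

Section GammaPositivity.
Variable R : realDomainType.
Local Notation S := ('X_idx_s : {mpoly R[2]}).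
Local Notation T := ('X_idx_t : {mpoly R[2]}).

Lemma gamma_positive_symmetric (f : {mpoly R[2]}) :
  gamma_positive f -> f \is mpoly.symmetric.
Proof.
case=> d _ [gamma _ ->]; apply: rpred_sum => i _; apply/rpredZ/rpredM.
  (* [S * T] and [S + T] are the elementary symmetric polynomials of degrees 2 and 1. *)
  rewrite rpredX //; have := mesym_sym 2 R 2.
  by rewrite mesymnnE !big_ord_recl big_ord0 mulr1 (_ : lift _ _ = idx_t) //;
    apply/val_inj.
rewrite rpredX //; have := mesym_sym 2 R 1.
by rewrite mesym1E !big_ord_recl big_ord0 addr0 (_ : lift _ _ = idx_t) //;
    apply/val_inj.
Qed.

(** Swapping the variables sends the exponent [e] of [T] to [n - e], so the smallest exponent [r]
    forces the largest to be [n - r]. *)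
Lemma symmetric_center (f : {mpoly R[2]}) n :
  f \is n.-homog -> f \is mpoly.symmetric -> f != 0 ->
  center_of_symmetry f (n%:R / 2).
Proof.
move=> /dhomogP f_homog f_sym f_neq0.
have exp_ex : exists e, e \in t_exponents f.
  case fE : (msupp f) => [|m r]; first by rewrite -msupp_eq0 fE in f_neq0.
  by exists (m idx_t); apply/mapP; exists m; rewrite // fE mem_head.
have exp_sym e : e \in t_exponents f -> (e <= n)%N /\ (n - e)%N \in t_exponents f.
  case/mapP => m mf ->.
  have mE : (m idx_s + m idx_t)%N = n.
    have <- : mdeg m = n := f_homog m mf.
    rewrite mdegE !big_ord_recl big_ord0 addn0.
    by congr (_ + m _)%N; apply/val_inj.
  split; first by rewrite -mE leq_addl.
  apply/mapP; exists [multinom m (tperm idx_s idx_t i) | i < 2].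
    by rewrite issym_msupp.
  by rewrite mnmE tpermR -mE addnK.
case: (ex_minnP exp_ex) => r r_exp r_min.
have [r_le nr_exp] := exp_sym _ r_exp.
exists r, (n - r)%N; split => //; last by rewrite subnK.
move=> e e_exp; rewrite r_min //=.
have [e_le /r_min] := exp_sym _ e_exp; lia.
Qed.

(** [R] may lack 1/2, so identities are proved for the doubled polynomials and then cancelled. *)
Lemma mpoly_two_inj (f g : {mpoly R[2]}) : 2 * f = 2 * g -> f = g.
Proof.
apply: mulfI; rewrite -[2](rmorph_nat (@mpolyC 2 R)) mpolyC_eq0.
by rewrite pnatr_eq0.
Qed.

Lemma words_poly_gamma_even m :
  words_poly R m.*2 =
  \sum_(i < m.+1) (4 ^ i * left_peaks m.*2 i)%:R * gamma_basis R m.*2 i.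
Proof.
rewrite words_poly_gamma.
rewrite [RHS](big_ord_widen m.*2.+1
  (fun i => (4 ^ i * left_peaks m.*2 i)%:R * gamma_basis R m.*2 i)); last by lia.
rewrite [RHS]big_mkcond; apply: eq_bigr => i _; case: ltnP => // mi.
by rewrite left_peaks_small ?muln0 ?mul0r //; lia.
Qed.

(** The gamma coefficients of half of B_n + e (s - t)^n for n = 2m, written without division: half
    of [4 ^ i] is [2 * 4 ^+ j] when [i = j.+1], and [c] stands for half of [1 + e] at index 0. *)
Definition half_gamma (m : nat) (c e : R) (i : nat) : R :=
  if i is j.+1 then
    2 * 4 ^+ j * ((left_peaks m.*2 i)%:R + e * (-1) ^+ i * 'C(m, i)%:R)
  else c.

Lemma double_half_gamma m c e i : 2 * c = 1 + e ->
  2 * half_gamma m c e i =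
  (4 ^ i * left_peaks m.*2 i)%:R + e * (-1) ^+ i * (4 ^ i * 'C(m, i))%:R.
Proof.
case: i => [|i] ce /=.
  by rewrite left_peaks0 bin0 expn0 expr0 muln1 !mulr1.
rewrite !natrM natrX (exprS 4).
by move: (left_peaks _ _)%:R ('C(_, _)%:R : R) ((-1) ^+ _ : R) (4 ^+ i : R) => *; ring.
Qed.

Lemma gamma_positive_half m (c e : R) (f : {mpoly R[2]}) :
  f \is m.*2.-homog -> 0 <= c -> 2 * c = 1 + e -> `|e| = 1 ->
  2 * f = words_poly R m.*2 + e%:MP * (S - T) ^+ m.*2 ->
  gamma_positive f.
Proof.
move=> f_homog c_ge0 ce e1 fE; exists m.*2 => //; rewrite doubleK.
exists (half_gamma m c e) => [[|i] _ //=|].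
  rewrite mulr_ge0 //; first by rewrite mulr_ge0 // exprn_ge0.
  (* As [e] is a sign, nonnegativity reduces to the binomial lower bound. *)
  have le1 : `|e * (-1) ^+ i.+1 * 'C(m, i.+1)%:R| <= (left_peaks m.*2 i.+1)%:R.
    rewrite normrM [e * _]mulrC normrMsign e1 mul1r normr_nat ler_nat.
    exact: bin_le_left_peaks.
  by move: le1; rewrite ler_norml addrC -lerBlDr sub0r => /andP[].
apply: mpoly_two_inj; rewrite fE words_poly_gamma_even signed_gamma !mulr_sumr.
rewrite -big_split; apply: eq_bigr => i _; rewrite -/(gamma_basis R m.*2 i) /=.
rewrite -mul_mpolyC [RHS]mulrA -[2](rmorph_nat (@mpolyC 2 R)) -rmorphM.
rewrite double_half_gamma // rmorphD !rmorphM /= !rmorph_nat rmorph_sign.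
by rewrite [RHS]mulrDl !mulrA.
Qed.

Lemma double_Bplus n : 2 * Bplus_poly R n = words_poly R n + (S - T) ^+ n.
Proof. by rewrite -Bplus_add_Bminus -Bplus_sub_Bminus; ring. Qed.

Lemma double_Bminus n : 2 * Bminus_poly R n = words_poly R n - (S - T) ^+ n.
Proof. by rewrite -Bplus_add_Bminus -Bplus_sub_Bminus; ring. Qed.

Lemma weight_homog n w : w \in words n -> weight R 0 w \is n.-homog.
Proof.
case/words_bound => <- _; rewrite /weight -(word_des_asc 0).
have homX (i : 'I_2) k : ('X_i : {mpoly R[2]}) ^+ k \is k.-homog.
  by rewrite -{2}(mul1n k) dhomogMn // dhomogX; apply/eqP/mdeg1.
exact: dhomogM.
Qed.

Lemma words_homog n (P : pred (seq int)) :
  \sum_(w <- words n | P w) weight R 0 w \is n.-homog.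
Proof.
by rewrite big_seq_cond rpred_sum // => w /andP[/weight_homog].
Qed.

Lemma words_neq_nil n : words n != [::].
Proof.
apply/negP => /eqP words0; have := mem_words n [seq k%:Z | k <- iota 1 n].
by rewrite words0 /unsign_word -map_comp map_id perm_refl.
Qed.

(** At s = t = 1 the power of [S - T] vanishes and every weight is 1, so twice [f] takes the number
    of words as its value, which is nonzero in [R]. *)
Lemma half_words_neq0 n (e : R) (f : {mpoly R[2]}) : (0 < n)%N ->
  2 * f = words_poly R n + e%:MP * (S - T) ^+ n -> f != 0.
Proof.
move=> n_gt0 fE; apply/eqP => f0; move: fE; rewrite f0 mulr0.
move/(congr1 (meval (fun=> 1))).
rewrite meval0 mevalD mevalM rmorphXn /= mevalB !mevalXU subrr expr0n.
rewrite (gtn_eqF n_gt0) mulr0 addr0 /words_poly raddf_sum /=.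
rewrite (eq_bigr (fun=> 1)) => [|w _]; last first.
  by rewrite /weight mevalM !rmorphXn /= !mevalXU !expr1n mulr1.
rewrite big_const_seq count_predT iter_addr_0 => /esym/eqP.
by rewrite pnatr_eq0 size_eq0 (negbTE (words_neq_nil n)).
Qed.

(** Where st = 0 only the term of index 0 survives, and its coefficient is 1. *)
Lemma words_poly_axis n (v : 'I_2 -> R) :
  v idx_s * v idx_t = 0 -> v idx_s + v idx_t = 1 -> (words_poly R n).@[v] = 1.
Proof.
move=> vM vD; rewrite words_poly_gamma raddf_sum /= big_ord_recl big1.
  rewrite left_peaks0 mul1r /gamma_basis expr0 mul1r rmorphXn /=.
  by rewrite mevalD !mevalXU vD expr1n addr0.
move=> i _; rewrite /gamma_basis !mevalM rmorphXn /= mevalM !mevalXU vM.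
by rewrite expr0n /= mul0r mulr0.
Qed.

Lemma gamma_positive_swap (f : {mpoly R[2]}) (v1 v2 : 'I_2 -> R) :
  v1 idx_s = v2 idx_t -> v1 idx_t = v2 idx_s ->
  gamma_positive f -> f.@[v1] = f.@[v2].
Proof.
move=> e1 e2 [d _ [gamma _ ->]]; rewrite !raddf_sum; apply: eq_bigr => i _ /=.
rewrite !mevalZ !mevalM !rmorphXn /= !mevalM !mevalD !mevalXU e1 e2.
by rewrite [v2 idx_t * _]mulrC [v2 idx_t + _]addrC.
Qed.

Lemma Bplus_not_gamma_positive n : odd n -> ~ gamma_positive (Bplus_poly R n).
Proof.
move=> n_odd.
pose v1 := fun i : 'I_2 => (i == idx_s)%:R : R.
pose v2 := fun i : 'I_2 => (i == idx_t)%:R : R.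
move/(@gamma_positive_swap _ v1 v2 erefl erefl) => e.
(* The doubled polynomial is 1 + 1 at (s, t) = (1, 0) and 1 - 1 at (0, 1), the exponent [n] being
   odd. *)
have := double_Bplus n => Bn.
have := congr1 (meval v1) Bn; have := congr1 (meval v2) Bn.
rewrite !mevalD !mevalM !rmorphXn /= !mevalB !mevalXU e !words_poly_axis
   /v1 /v2 /= ?mulr0 ?mul0r ?addr0 ?add0r //.
rewrite subr0 expr1n -signr_odd n_odd expr1 subrr !rmorph_nat => ->.
by move=> /esym/eqP; rewrite (@pnatr_eq0 R 2).
Qed.

End GammaPositivity.

Theorem theorem29 (R : realDomainType) (n : nat) (hn : (2 <= n)%N) :
  [/\ gamma_positive (Bplus_poly R n),
      gamma_positive (Bminus_poly R n),
      center_of_symmetry (Bplus_poly R n) (n%:R / 2)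
    & center_of_symmetry (Bminus_poly R n) (n%:R / 2)]
  <-> (n = 0 %[mod 2])%N.
Proof.
rewrite modn2 mod0n; split=> [[gammaB _ _ _]|].
  by case n_odd: (odd n) => //; case: (Bplus_not_gamma_positive n_odd gammaB).
move=> /eqP; rewrite eqb0 => n_even; have nE := even_halfK n_even.
have n_gt0 := ltnW hn.
have homP : Bplus_poly R n \is n.-homog by rewrite Bplus_poly_words words_homog.
have homM : Bminus_poly R n \is n.-homog by rewrite Bminus_poly_words words_homog.
have eP : 2 * Bplus_poly R n = words_poly R n + 1%:MP * ('X_idx_s - 'X_idx_t) ^+ n.
  by rewrite mul1r double_Bplus.
have eM : 2 * Bminus_poly R n = words_poly R n + (-1)%:MP * ('X_idx_s - 'X_idx_t) ^+ n.
  by rewrite rmorphN1 mulN1r double_Bminus.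
have gP : gamma_positive (Bplus_poly R n).
  (* The value of [c] is the coefficient of s^n: the identity, the only signed permutation without
     descents, is even. Hence [c] is 1 here and 0 for the odd part. *)
  apply: (@gamma_positive_half _ n./2 1 1); rewrite ?nE ?normr1 ?mulr1 //.
have gM : gamma_positive (Bminus_poly R n).
  apply: (@gamma_positive_half _ n./2 0 (-1)); rewrite ?nE ?normrN1 ?mulr0 ?subrr //.
by split=> //; apply: symmetric_center => //; try exact: gamma_positive_symmetric;
  [exact: half_words_neq0 eP|exact: half_words_neq0 eM].
Qed.
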